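(* Let $f:[0,1]\to\mathbb{R}$ be an arbitrary continuous function, and let $H\in{}^{\ast}\mathbb{N}\setminus\mathbb{N}$ be an infinite hypernatural number. Put $p_i=\frac{i}{H}$ for $i=1,\ldots,H$, let $\psi$ be the internal permutation of the hyperfinite grid $G_H=\{p_1,\ldots,p_H\}$ that arranges the grid by decreasing value of $f$ (as specified in the context), and let $\hat g(p_i)=f(\psi(p_i))$ for $i=1,\ldots,H$. Then there is a standard continuous real function $g:[0,1]\to\mathbb{R}$ such that $$g(\mathrm{st}(p_i))=\mathrm{st}(\hat g(p_i))\quad\text{for all } i=1,\ldots,H.$$
   Context: We work in a nonstandard (hyperreal) extension ${}^{\ast}\mathbb{R}$ of $\mathbb{R}$ satisfying the transfer principle for internal sets and functions. ${}^{\ast}\mathbb{N}$ denotes the hypernatural numbers, and the natural extension ${}^{\ast}f:{}^{\ast}[0,1]\to{}^{\ast}\mathbb{R}$ of a function $f:[0,1]\to\mathbb{R}$ is still denoted by $f$. Indices $i=1,\ldots,H$ range over all hypernaturals with $1\le i\le H$. A hyperreal $y$ is finite if $|y|$ is smaller than some real number, and infinitesimal if $|y|$ is smaller than every positive real number. For a finite hyperreal $y$, its standard part $\mathrm{st}(y)$ is the unique real number $y_0$ such that $y-y_0$ is infinitesimal. The permutation $\psi$: by the transfer principle, as for finite sets, there is an internal bijection $\psi:G_H\to G_H$ that lists the points of $G_H$ by (non-strictly) decreasing value of $f$, i.e. $f(\psi(p_1))\ge f(\psi(p_2))\ge\cdots\ge f(\psi(p_H))$ (so that $f(\psi(p_1))$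 is the maximal value of $f$ on $G_H$), with points at which $f$ takes equal values listed in increasing order: if $i<j$ and $f(\psi(p_i))=f(\psi(p_j))$ then $\psi(p_i)<\psi(p_j)$. Thus $\hat g:G_H\to{}^{\ast}\mathbb{R}$ is an internal function which is (perhaps non-strictly) decreasing on $G_H$. *)

(* Defs.v *)
From mathcomp Require Import all_boot all_order all_algebra.
From mathcomp Require Import boolp classical_sets functions reals.
From mathcomp Require Import topology normedtype.

Set Implicit Arguments.
Unset Strict Implicit.
Unset Printing Implicit Defensive.

Import Order.TTheory GRing.Theory Num.Theory.
Import numFieldNormedType.Exports.

Local Open Scope classical_set_scope.
Local Open Scope ring_scope.

(** * Nonstandard extensions of the reals

A nonstandard extension is axiomatized by the transfer principle, without
fixing a particular construction such as an ultrapower.  The objects concerned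
are those of the finite types over the reals: reals, sets, functions, sets of
functions, and so on.  Relations and functions of several arguments are
curried.  An extension provides, for each finite type, a type of internal
objects.  Quantifiers in a transferred sentence range over internal objects. *)

Inductive ftype : Type :=
| treal
| tset of ftype
| tfun of ftype & ftype.

Fixpoint std (R : realType) (s : ftype) : Type :=
  match s with
  | treal => R
  | tset s => set (std R s)
  | tfun s t => std R s -> std R t
  end.

(** Formulas are given as syntax (with de Bruijn variables) rather than as
Rocq propositions, so that the two readings of a formula, standard and
internal, are those of one and the same expression.  Every standard object is
available as a constant. *)

Inductive var : seq ftype -> ftype -> Type :=
| v0 c s : var (s :: c) s
| vS c s t : var c s -> var (t :: c) s.

Inductive term (R : realType) (c : seq ftype) : ftype -> Type :=
| Var s : var c s -> term R c s
| Cst s : std R s -> term R c s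
| App s t : term R c (tfun s t) -> term R c s -> term R c t.

Arguments Cst {R c} s _.

Inductive formula (R : realType) : seq ftype -> Type :=
| fEq c s : term R c s -> term R c s -> formula R c
| fMem c s : term R c s -> term R c (tset s) -> formula R c
| fNot c : formula R c -> formula R c
| fAnd c : formula R c -> formula R c -> formula R c
| fOr c : formula R c -> formula R c -> formula R c
| fImp c : formula R c -> formula R c -> formula R c
| fAll c s : formula R (s :: c) -> formula R c
| fEx c s : formula R (s :: c) -> formula R c.

Record structure (R : realType) : Type := Structure {
  dom : ftype -> Type;
  ap : forall s t : ftype, dom (tfun s t) -> dom s -> dom t;
  mem_in : forall s : ftype, dom (tset s) -> set (dom s);
  star : forall s : ftype, std R s -> dom s
}.

Arguments ap {R _ s t} _ _.
Arguments mem_in {R _ s} _ _.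
Arguments star {R} _ s _.

Fixpoint env (D : ftype -> Type) (c : seq ftype) : Type :=
  match c with
  | [::] => unit
  | s :: c => (D s * env D c)%type
  end.

Fixpoint lookup (D : ftype -> Type) (c : seq ftype) (s : ftype)
    (v : var c s) : env D c -> D s :=
  match v in var c s return env D c -> D s with
  | v0 _ _ => fun e => e.1
  | vS _ _ _ v => fun e => lookup v e.2
  end.

Fixpoint eval (R : realType) (X : structure R) (c : seq ftype)
    (e : env (dom X) c) (s : ftype) (t : term R c s) : dom X s :=
  match t with
  | Var _ v => lookup v e
  | Cst s a => star X s a
  | App _ _ u v => ap (eval e u) (eval e v)
  end.

Fixpoint holds (R : realType) (X : structure R) (c : seq ftype)
    (phi : formula R c) : env (dom X) c -> Prop :=
  match phi in formula _ c return env (dom X) c -> Prop with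
  | fEq _ _ t u => fun e => eval e t = eval e u
  | fMem _ _ t u => fun e => mem_in (eval e u) (eval e t)
  | fNot _ p => fun e => ~ holds p e
  | fAnd _ p q => fun e => holds p e /\ holds q e
  | fOr _ p q => fun e => holds p e \/ holds q e
  | fImp _ p q => fun e => holds p e -> holds q e
  | fAll c s p => fun e => forall a : dom X s, @holds R X (s :: c) p (a, e)
  | fEx c s p => fun e => exists a : dom X s, @holds R X (s :: c) p (a, e)
  end.

Definition standard_structure (R : realType) : structure R :=
  @Structure R (std R) (fun _ _ F a => F a) (fun _ A => A) (fun _ a => a).

Record nonstandard_extension (R : realType) : Type := NonstandardExtension {
  internal :> structure R;
  transfer : forall phi : formula R [::],
    @holds R (standard_structure R) [::] phi tt <-> @holds R internal [::] phi tt
}.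

(** * Hyperreals *)

Section Hyperreals.
Variables (R : realType) (X : nonstandard_extension R).

Definition hyperreal : Type := dom X treal.

Definition hreal (r : R) : hyperreal := star X treal r.

(** The natural extension of [f], as an internal function. *)
Definition hfun (f : R -> R) : dom X (tfun treal treal) :=
  star X (tfun treal treal) f.

Definition hop2 (op : R -> R -> R) (x y : hyperreal) : hyperreal :=
  ap (ap (star X (tfun treal (tfun treal treal)) op) x) y.

Definition hrel2 (rel : R -> set R) (x y : hyperreal) : Prop :=
  mem_in (ap (star X (tfun treal (tset treal)) rel) x) y.

Definition hsub : hyperreal -> hyperreal -> hyperreal :=
  hop2 (fun x y => x - y).
Definition hdiv : hyperreal -> hyperreal -> hyperreal :=
  hop2 (fun x y => x / y).
Definition habs (x : hyperreal) : hyperreal := ap (hfun (fun r => `|r|)) x.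
Definition hlt : hyperreal -> hyperreal -> Prop :=
  hrel2 (fun x => [set y | x < y]).
Definition hle : hyperreal -> hyperreal -> Prop :=
  hrel2 (fun x => [set y | x <= y]).

Definition hypernat : set hyperreal :=
  mem_in (star X (tset treal) (range (fun n : nat => n%:R : R))).

Definition infinite_hypernat : set hyperreal :=
  hypernat `\` range (fun n : nat => hreal n%:R).

Definition finite_hyperreal (y : hyperreal) : Prop :=
  exists r : R, hlt (habs y) (hreal r).

Definition infinitesimal (y : hyperreal) : Prop :=
  forall r : R, 0 < r -> hlt (habs y) (hreal r).

(** Meaningful for finite [y] only; [0] is returned otherwise. *)
Definition st (y : hyperreal) : R :=
  xget 0 [set r : R | infinitesimal (hsub y (hreal r))].

(** * The grid and its rearrangement *)

(** The indices [1 <= i <= H]. *)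
Definition hindex (H : hyperreal) : set hyperreal :=
  [set i | [/\ hypernat i, hle (hreal 1) i & hle i H]].

Definition gridpt (H i : hyperreal) : hyperreal := hdiv i H.

Definition grid (H : hyperreal) : set hyperreal := gridpt H @` hindex H.

Definition rearranged (f : R -> R) (psi : dom X (tfun treal treal))
    (x : hyperreal) : hyperreal := ap (hfun f) (ap psi x).

(** An internal map on the grid is given by an internal function on all of the
hyperreals, whose values outside the grid are irrelevant. *)
Definition decreasing_arrangement (f : R -> R) (H : hyperreal)
    (psi : dom X (tfun treal treal)) : Prop :=
  [/\ set_bij (grid H) (grid H) (ap psi),
      forall i j : hyperreal, hindex H i -> hindex H j -> hlt i j ->
        hle (rearranged f psi (gridpt H j)) (rearranged f psi (gridpt H i))
    & forall i j : hyperreal, hindex H i -> hindex H j -> hlt i j ->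
        rearranged f psi (gridpt H i) = rearranged f psi (gridpt H j) ->
        hlt (ap psi (gridpt H i)) (ap psi (gridpt H j))].

End Hyperreals.

(* Main.v *)
Require Import Defs.
From mathcomp Require Import all_boot all_order all_algebra.
From mathcomp Require Import boolp classical_sets functions reals.
From mathcomp Require Import topology normedtype.
From mathcomp Require Import zify lra.

(** The values of [f] along the rearranged grid are equicontinuous, uniformly in
the size of the grid, and this is a statement about the standard reals.  For a
grid [{1/h, ..., h/h}] sorted by decreasing [f], let position [i] carry the
value [B] and a later position [j] a value [A] at least [2e] smaller.  By the
intermediate value theorem [f] takes the value [(A + B) / 2] at some [c], and by
uniform continuity [f] stays strictly between [A] and [B] on an interval of
fixed length [eta], starting or ending at [c].  Since the grid is sorted, every
grid point of that interval is listed strictly between positions [i] and [j];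
counting these points yields [j - i >= eta * h], that is,
[j/h - i/h >= eta] ([rearrangement_gap]).  So grid points at distance less than
[eta] carry values at distance less than [2e] ([rearrangement_modulus]).  Here
[eta] depends on [f] and [e] only, so the transfer principle carries the
estimate over to the hyperfinite grid ([arrangement_modulus]).

It remains to take standard parts.  A hyperreal [y] defines an ultrafilter on
the reals, formed by the sets [A] such that [y] belongs to the extension of [A]
([hfilter]), and [st y] is the limit of this ultrafilter.  In this language the
existence of the standard parts of the points and of the values is the
compactness of [[0, 1]] and of its image under [f], and inequalities pass to
standard parts as they pass to limits.  Every real of [[0, 1]] is the standard
part of a grid point ([grid_dense]); mapping it to the standard part of the
value carried by such a point gives [g].  The transferred estimate shows that
[g] is continuous and independent of the chosen grid point
([standard_parts_modulus]). *)

Set Implicit Arguments.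
Unset Strict Implicit.
Unset Printing Implicit Defensive.

Import Order.TTheory GRing.Theory Num.Theory.
Import numFieldNormedType.Exports.

Local Open Scope classical_set_scope.
Local Open Scope ring_scope.

(** * Continuous functions on a segment *)

(** Heine-Cantor: for each centre [x] some [d] works throughout a neighbourhood
of [x], and compactness of the segment makes the choice of [d] uniform. *)
Lemma uniform_continuity_on_segment (R : realType) (f : R -> R) (a b : R) :
  {within `[a, b], continuous f} -> forall e : R, 0 < e ->
  exists2 d : R, 0 < d & forall x y, x \in `[a, b] -> y \in `[a, b] ->
    `|x - y| < d -> `|f x - f y| < e.
Proof.
move=> /subspace_continuousP fc e e0.
have /compact_near_coveringP/near_covering_withinP cov :=
  @segment_compact R a b.
have e20 : 0 < e / 2 by lra.
pose good (d x : R) :=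
  forall y, y \in `[a, b] -> `|x - y| < d -> `|f x - f y| < e.
have := cov R (0^'+) good; case=> // [x xab|].
  have /cvgrPdist_lt/(_ _ e20) := fc x xab.
  rewrite near_withinE => /nbhs_ballP[r/= r0 xr].
  have r20 : 0 < r / 2 by lra.
  exists (ball x (r / 2), [set d | d < r / 2]) => /=.
    by split; [exact: nbhsx_ballx|exact: nbhs_right_lt].
  move=> [x' d] /= [xx' dr] x'ab y yab x'yd.
  have fxx' : `|f x - f x'| < e / 2.
    by apply: xr => //; apply: le_ball xx'; lra.
  have fxy : `|f x - f y| < e / 2.
    apply: xr => //; rewrite /ball/= in xx' *.
    rewrite (_ : x - y = (x - x') + (x' - y)); last by lra.
    by apply: (le_lt_trans (ler_normD _ _)); lra.
  rewrite (_ : f x' - f y = (f x - f y) - (f x - f x')); last by lra.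
  by apply: (le_lt_trans (ler_normB _ _)); lra.
move=> r /= r0 hr; exists (r / 2); first by lra.
move=> x y xab yab xy; apply: (hr (r / 2)) => //=; last by lra.
by rewrite sub0r normrN gtr0_norm; lra.
Qed.

Lemma intermediate_value (R : realType) (f : R -> R) (a b s t v : R) :
  {within `[a, b], continuous f} -> s \in `[a, b] -> t \in `[a, b] ->
  f s <= v <= f t -> exists2 c, c \in `[a, b] & f c = v.
Proof.
move=> fc sab tab /andP[sv vt].
have sub x y : x \in `[a, b] -> y \in `[a, b] -> `[x, y] `<=` `[a, b].
  move=> + + z /=; rewrite !in_itv/= => /andP[ax _] /andP[_ yb] /andP[xz zy].
  by rewrite (le_trans ax xz) (le_trans zy yb).
have [st|/ltW ts] := leP s t.
  have fst_ := continuous_subspaceW (sub _ _ sab tab) fc.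
  have [|c cst <-] := IVT st fst_ (v := v).
    by rewrite ge_min sv le_max vt orbT.
  by exists c => //; exact: (sub s t).
have fts := continuous_subspaceW (sub _ _ tab sab) fc.
have [|c cts <-] := IVT ts fts (v := v).
  by rewrite ge_min sv le_max vt orbT.
by exists c => //; exact: (sub t s).
Qed.

(** * The rearrangement of a finite grid *)

(** An open interval of length [L] contains at least [L - 1] integers, and
[j - i - 1] labels are available: the two losses of one cancel, which is why the
bound has no error term. *)
Lemma interval_length_le_labels (R : realType) (u L : R) (i j : nat)
    (k : nat -> nat) :
  0 <= u -> (i < j)%N ->
  (forall m, u < m%:R < u + L -> (i < k m < j)%N) ->
  (forall m m', u < m%:R < u + L -> u < m'%:R < u + L ->
    k m = k m' -> m = m') ->
  L <= (j - i)%:R.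
Proof.
move=> u0 ij kij kinj; rewrite leNgt; apply/negP => dL.
have /andP[m0u um0] := truncn_itv u0; set m0 := Num.truncn u in m0u um0.
(* If [j - i < L], the first [j - i] integers after [u] lie in the interval. *)
pose s := iota m0.+1 (j - i).
have sin m : m \in s -> u < m%:R < u + L.
  rewrite mem_iota => /andP[m0m mm0]; apply/andP; split.
    by apply: lt_le_trans um0 _; rewrite ler_nat.
  have : m%:R <= m0%:R + (j - i)%:R :> R by rewrite -natrD ler_nat; lia.
  by lra.
have uk : uniq (map k s).
  rewrite map_inj_in_uniq ?iota_uniq// => m m' /sin ms /sin m's.
  exact: kinj.
have : {subset map k s <= iota i.+1 (j - i).-1}.
  move=> _ /mapP[m /sin /kij ms ->]; rewrite mem_iota; lia.
move=> /(uniq_leq_size uk); rewrite size_map !size_iota; lia.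
Qed.

Definition index_set (R : realType) (h : R) : set R :=
  [set k | range (fun n : nat => n%:R : R) k /\ 1 <= k /\ k <= h].

(** Quantified over indices rather than phrased as a bijection of sets, so that
a first-order formula expresses it word for word. *)
Definition sorts_grid (R : realType) (f : R -> R) (h : R) (psi : R -> R) :=
  (forall k, index_set h k ->
    exists m, index_set h m /\ psi (k / h) = m / h) /\
  (forall k, index_set h k ->
    exists m, index_set h m /\ psi (m / h) = k / h) /\
  (forall k m, index_set h k -> index_set h m -> k < m ->
    f (psi (m / h)) <= f (psi (k / h))).

Lemma gridpt_unit (R : realType) (h k : R) :
  index_set h k -> k / h \in `[0, 1].
Proof.
move=> [_ [k1 kh]]; have h0 : 0 < h by lra.
by rewrite in_itv/= divr_ge0 ?ler_pdivrMr//; lra.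
Qed.

(** A drop of [2 * e] between positions [i] and [j] takes room: around a point
where [f] has the middle value there is an interval of length [eta] on which
[f] stays between the two values, and the sorting lists all grid points of this
interval between [i] and [j]. *)
Lemma rearrangement_gap (R : realType) (f psi : R -> R) (e eta h i j : R) :
  {within `[0, 1], continuous f} -> 0 < eta -> eta <= 1 / 2 ->
  (forall x y, x \in `[0, 1] -> y \in `[0, 1] -> `|x - y| < eta ->
    `|f x - f y| < e) ->
  sorts_grid f h psi -> index_set h i -> index_set h j -> i < j ->
  f (psi (j / h)) + 2 * e <= f (psi (i / h)) ->
  eta <= j / h - i / h.
Proof.
move=> fc eta0 eta12 unif [maps [surj mono]] hi hj ij AB.
have psi01 k : index_set h k -> psi (k / h) \in `[0, 1].
  by move=> /maps[m [hm ->]]; exact: gridpt_unit.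
have e0 : 0 < e.
  have O01 : 0 \in `[0, 1 : R] by rewrite in_itv/= lexx ler01.
  by apply: le_lt_trans (unif 0 0 O01 O01 _); rewrite subrr normr0.
have [c c01 fcE] : exists2 c, c \in `[0, 1] &
    f c = (f (psi (j / h)) + f (psi (i / h))) / 2.
  apply: (@intermediate_value _ f 0 1 (psi (j / h)) (psi (i / h))) => //.
  - exact: psi01.
  - exact: psi01.
  - by apply/andP; split; lra.
have [[[i' _ i'E] [i1 ih]] [[j' _ j'E] [j1 jh]]] := (hi, hj).
have h0 : 0 < h by lra.
(* As [eta <= 1 / 2], one of the two sides of [c] has room for the interval. *)
pose u := if c + eta <= 1 then c else c - eta.
have u01 : 0 <= u /\ u + eta <= 1.
  by move: c01; rewrite in_itv/= /u => /andP[? ?]; case: ifPn; lra.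
have fu x : u < x < u + eta -> f (psi (j / h)) < f x < f (psi (i / h)).
  move=> ux; have : `|f x - f c| < e.
    apply: unif => //; first by rewrite in_itv/=; lra.
    by rewrite ltr_norml; move: ux; rewrite /u; case: ifPn; lra.
  by rewrite fcE ltr_norml; lra.
have pre (m : nat) : exists n : nat, index_set h m%:R ->
    index_set h n%:R /\ psi (n%:R / h) = m%:R / h.
  have [/surj[_ [[[n _ <-] [n1 nh]] nE]]|Nm] := pselect (index_set h m%:R).
    by exists n => _; split=> //; split=> //; exists n.
  by exists 0%N.
have [k kP] := choice pre.
have inside (m : nat) : u * h < m%:R < u * h + eta * h ->
    index_set h m%:R /\ u < m%:R / h < u + eta.
  move=> /andP[um mu]; split; last first.
    by rewrite ltr_pdivlMr// ltr_pdivrMr// mulrDl um mu.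
  split; first by exists m.
  split.
    rewrite ler1n -(ltr_nat R); apply: le_lt_trans um.
    by rewrite mulr_ge0; lra.
  by apply: le_trans (ltW mu) _; rewrite -mulrDl ler_piMl; lra.
have ij' : (i' < j')%N by rewrite -(ltr_nat R) i'E j'E.
have : eta * h <= (j' - i')%:R.
  apply: (@interval_length_le_labels _ (u * h) _ i' j' k) => //.
  - by rewrite mulr_ge0; lra.
  - move=> m /inside[hm /fu]; have [hk <-] := kP m hm.
    move=> /andP[fj fi]; apply/andP; split; rewrite ltnNge; apply/negP.
      rewrite leq_eqVlt => /orP[/eqP kE|].
        by move: fi; rewrite kE i'E ltxx.
      by rewrite -(ltr_nat R) i'E => /(mono _ _ hk hi); lra.
    rewrite leq_eqVlt => /orP[/eqP kE|].
      by move: fj; rewrite -kE j'E ltxx.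
    by rewrite -(ltr_nat R) j'E => /(mono _ _ hj hk); lra.
  - move=> m m' /inside[hm _] /inside[hm' _] kE.
    have [_ mE] := kP m hm; have [_ m'E] := kP m' hm'.
    apply/eqP; rewrite -(eqr_nat R); apply/eqP/(mulIf (x := h^-1)).
      by rewrite invr_eq0 gt_eqF.
    by rewrite -mE -m'E kE.
by rewrite natrB 1?ltnW// i'E j'E -mulrBl ler_pdivlMr.
Qed.

(** The quantifier order is the point: [d] is chosen before the grid size [h]
and the sorting [psi], so that it can be a standard constant when [h] and [psi]
become nonstandard. *)
Lemma rearrangement_modulus (R : realType) (f : R -> R) (e : R) :
  {within `[0, 1], continuous f} -> 0 < e -> exists2 d : R, 0 < d &
  forall (h : R) (psi : R -> R), sorts_grid f h psi ->
  forall i j, index_set h i -> index_set h j -> `|i / h - j / h| < d ->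
  `|f (psi (i / h)) - f (psi (j / h))| < e.
Proof.
move=> fc e0; have e20 : 0 < e / 2 by lra.
have [d d0 unif] := uniform_continuity_on_segment fc e20.
exists (Num.min d (1 / 2)); first by rewrite lt_min d0; lra.
move=> h psi sorted i j.
wlog ij : i j / i <= j => [th|] hi hj.
  case: (leP i j) => [|/ltW] ij; first exact: th.
  by rewrite distrC => H; rewrite distrC; exact: th.
move: ij; rewrite le_eqVlt => /orP[/eqP->|ij]; first by rewrite !subrr normr0.
have [_ [_ mono]] := sorted.
move=> dij; rewrite ger0_norm ?subr_ge0 ?mono// ltNge; apply/negP => AB.
suff : Num.min d (1 / 2) <= j / h - i / h.
  by move: dij; rewrite distrC ltr_norml => /andP[_ ?]; lra.
apply: (@rearrangement_gap _ f psi (e / 2) _ h) => //.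
- by rewrite lt_min d0; lra.
- by rewrite ge_min lexx orbT.
- move=> x y x01 y01 xy; apply: unif => //.
  by apply: lt_le_trans xy _; rewrite ge_min lexx.
- by lra.
Qed.

(** * Formulas for transfer *)

(** The terms and formulas below are built so that their two readings are
convertible to the intended propositions: a proof over the reals is a proof of
the standard reading as it stands, and the internal reading can be applied
directly to hyperreals. *)

Section Formulas.
Variable R : realType.

Definition bv0 c s : term R (s :: c) s := Var R (v0 c s).
Definition bv1 c s t : term R (t :: s :: c) s := Var R (vS t (v0 c s)).
Definition bv2 c s t u : term R (u :: t :: s :: c) s :=
  Var R (vS u (vS t (v0 c s))).
Definition bv3 c s t u v : term R (v :: u :: t :: s :: c) s :=
  Var R (vS v (vS u (vS t (v0 c s)))).

Definition numT c (r : R) : term R c treal := Cst treal r.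

Definition funT c (f : R -> R) (t : term R c treal) : term R c treal :=
  App (Cst (tfun treal treal) f) t.

Definition opT c (op : R -> R -> R) (t u : term R c treal) : term R c treal :=
  App (App (Cst (tfun treal (tfun treal treal)) op) t) u.

Definition setF c (A : set R) (t : term R c treal) : formula R c :=
  fMem t (Cst (tset treal) A).

Definition relF c (P : R -> set R) (t u : term R c treal) : formula R c :=
  fMem u (App (Cst (tfun treal (tset treal)) P) t).

Definition leF c (t u : term R c treal) : formula R c :=
  relF (fun x => [set y | x <= y]) t u.

Definition ltF c (t u : term R c treal) : formula R c :=
  relF (fun x => [set y | x < y]) t u.

Definition natF c (t : term R c treal) : formula R c :=
  setF (range (fun n : nat => n%:R)) t.

Definition gridT c (h k : term R c treal) : term R c treal :=
  opT (fun x y => x / y) k h.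

Definition indexF c (h k : term R c treal) : formula R c :=
  fAnd (natF k) (fAnd (leF (numT c 1) k) (leF k h)).

End Formulas.

Arguments bv0 {R c s}.
Arguments bv1 {R c s t}.
Arguments bv2 {R c s t u}.
Arguments bv3 {R c s t u v}.
Arguments numT {R c} r.

Declare Scope formula_scope.
Local Open Scope formula_scope.
Local Notation "'ALL' s , p" := (@fAll _ _ s p)
  (at level 200, s at level 0, p at level 200) : formula_scope.
Local Notation "'EX' s , p" := (@fEx _ _ s p)
  (at level 200, s at level 0, p at level 200) : formula_scope.
Local Notation "p |=> q" := (fImp p q)
  (at level 90, right associativity) : formula_scope.
Local Notation "p |& q" := (fAnd p q)
  (at level 80, right associativity) : formula_scope.
Local Notation std_holds phi :=
  (@holds _ (standard_structure _) [::] phi tt).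

Section Transfer.
Variables (R : realType) (X : nonstandard_extension R).
Implicit Types (y z : hyperreal X) (A : set R) (P Q S : R -> set R).

Lemma hindexP (H i : hyperreal X) :
  hindex H i <-> hypernat i /\ hle (hreal X 1) i /\ hle i H.
Proof. by split=> [[]|[? []]]. Qed.

Lemma arrangement_modulus (f : R -> R) (e : R) :
  {within `[0, 1], continuous f} -> 0 < e -> exists2 d : R, 0 < d &
  forall (H : hyperreal X) psi, decreasing_arrangement f H psi ->
  forall i j, hindex H i -> hindex H j ->
  hrel2 (fun x => [set y | `|x - y| < d]) (gridpt H i) (gridpt H j) ->
  hrel2 (fun x => [set y | `|x - y| < e])
    (rearranged f psi (gridpt H i)) (rearranged f psi (gridpt H j)).
Proof.
move=> fc e0; have [d d0 modulus] := rearrangement_modulus fc e0.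
exists d => // H psi [[maps _ surj] mono _] i j /hindexP hi /hindexP hj.
pose phi : formula R [::] := ALL treal, ALL (tfun treal treal),
  ((ALL treal, indexF bv2 bv0 |=> EX treal, indexF bv3 bv0 |&
      fEq (App bv2 (gridT bv3 bv1)) (gridT bv3 bv0)) |&
   (ALL treal, indexF bv2 bv0 |=> EX treal, indexF bv3 bv0 |&
      fEq (App bv2 (gridT bv3 bv0)) (gridT bv3 bv1)) |&
   (ALL treal, ALL treal, indexF bv3 bv1 |=> indexF bv3 bv0 |=>
      ltF bv1 bv0 |=> leF (funT f (App bv2 (gridT bv3 bv0)))
                          (funT f (App bv2 (gridT bv3 bv1))))) |=>
  ALL treal, ALL treal, indexF bv3 bv1 |=> indexF bv3 bv0 |=>
    relF (fun x => [set y | `|x - y| < d]) (gridT bv3 bv1) (gridT bv3 bv0) |=>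
    relF (fun x => [set y | `|x - y| < e])
      (funT f (App bv2 (gridT bv3 bv1))) (funT f (App bv2 (gridT bv3 bv0))).
have /(transfer X phi) : std_holds phi by exact: modulus.
move/(_ H psi); apply => //; split; [|split].
- move=> k /hindexP hk.
  have [m hm mE] := maps _ (imageP _ hk).
  by exists m; split; [exact/hindexP|exact/esym].
- move=> k /hindexP hk.
  have [_ [m hm <-] mE] := surj _ (imageP _ hk).
  by exists m; split; [exact/hindexP|].
- by move=> k m /hindexP hk /hindexP hm; exact: mono.
Qed.

(** * The filters of a hyperreal and of a pair of hyperreals *)

Definition hfilter y : set_system R :=
  [set A | mem_in (star X (tset treal) A) y].

Definition hfilter2 y z : set_system (R * R) :=
  [set U | hrel2 (fun a => [set b | U (a, b)]) y z].

Lemma hrel2_setT y z : hrel2 (fun=> setT) y z.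
Proof.
pose phi : formula R [::] := ALL treal, ALL treal, relF (fun=> setT) bv1 bv0.
have /(transfer X phi) : std_holds phi by [].
by apply.
Qed.

(** Stability under supersets and under intersections in one statement: take
[Q := P], or [S] the conjunction of [P] and [Q]. *)
Lemma hrel2_imply P Q S y z : (forall a b, P a b -> Q a b -> S a b) ->
  hrel2 P y z -> hrel2 Q y z -> hrel2 S y z.
Proof.
pose phi : formula R [::] := ALL treal, ALL treal,
  relF P bv1 bv0 |=> relF Q bv1 bv0 |=> relF S bv1 bv0.
by move/(transfer X phi); exact.
Qed.

Lemma hrel2_standard_witness P y z : hrel2 P y z -> exists a b, P a b.
Proof.
pose phi : formula R [::] := EX treal, EX treal, relF P bv1 bv0.
by move=> yz; apply/(transfer X phi); exists y, z.
Qed.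

Global Instance hfilter2_proper y z : ProperFilter (hfilter2 y z).
Proof.
split; first by move=> /hrel2_standard_witness[a [b []]].
split; first exact: hrel2_setT.
  by move=> U V; apply: hrel2_imply.
by move=> U V UV U_; apply: hrel2_imply (U_) (U_) => a b /UV.
Qed.

Lemma hfilterE_fst y z : hfilter y = fst @ hfilter2 y z.
Proof.
apply/funext => A; apply/propext; pose P a := [set b : R | A a].
pose phi : formula R [::] := ALL treal, ALL treal,
  (setF A bv1 |=> relF P bv1 bv0) |& (relF P bv1 bv0 |=> setF A bv1).
have /(transfer X phi) : std_holds phi by move=> a b; split.
by apply.
Qed.

Lemma hfilterE_snd y z : hfilter z = snd @ hfilter2 y z.
Proof.
apply/funext => A; apply/propext; pose P (a : R) := A.
pose phi : formula R [::] := ALL treal, ALL treal,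
  (setF A bv0 |=> relF P bv1 bv0) |& (relF P bv1 bv0 |=> setF A bv0).
have /(transfer X phi) : std_holds phi by move=> a b; split.
by apply.
Qed.

Global Instance hfilter_proper y : ProperFilter (hfilter y).
Proof. by rewrite (hfilterE_fst y y); exact: fmap_proper_filter. Qed.

Lemma hfilter_setVsetC A y : hfilter y A \/ hfilter y (~` A).
Proof.
pose phi : formula R [::] := ALL treal, fOr (setF A bv0) (setF (~` A) bv0).
have /(transfer X phi) : std_holds phi by move=> a; exact: lem.
by apply.
Qed.

Lemma hfilter_cvgP y (r : R) :
  hfilter y --> r <-> forall e, 0 < e -> hfilter y [set a | `|a - r| < e].
Proof. exact: (@cvgrPdistC_lt _ _ _ (hfilter y) _ (fun a : R => a)). Qed.

(** Compactness gives a cluster point, and the filter, being an ultrafilter,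
converges to it. *)
Lemma hfilter_compact_cvg A y : compact A -> hfilter y A ->
  exists2 r, A r & hfilter y --> r.
Proof.
move=> cA yA; have [r [Ar yr]] := cA _ (hfilter_proper y) yA.
exists r => // B rB; have [//|yNB] := hfilter_setVsetC B y.
by have [b []] := yr _ _ yNB rB.
Qed.

Lemma hfilter2_cvg_dist y z (r s : R) : hfilter y --> r -> hfilter z --> s ->
  `|p.1 - p.2| @[p --> hfilter2 y z] --> `|r - s|.
Proof.
rewrite (hfilterE_fst y z) (hfilterE_snd y z) => yr zs.
by apply: cvg_norm; exact: cvgB.
Qed.

(** * Standard parts as limits *)

Lemma hlt_habs_hsub y (r e : R) :
  hlt (habs (hsub y (hreal X r))) (hreal X e) <->
  hfilter y [set a | `|a - r| < e].
Proof.
pose lhs : formula R [:: treal] :=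
  ltF (funT (fun a => `|a|) (opT (fun a b => a - b) bv0 (numT r))) (numT e).
pose rhs : formula R [:: treal] := setF [set a | `|a - r| < e] bv0.
pose phi : formula R [::] := ALL treal, (lhs |=> rhs) |& (rhs |=> lhs).
have /(transfer X phi) : std_holds phi by move=> a; split.
by apply.
Qed.

Lemma hlt_habs y (e : R) :
  hlt (habs y) (hreal X e) <-> hfilter y [set a | `|a| < e].
Proof.
pose lhs : formula R [:: treal] := ltF (funT (fun a => `|a|) bv0) (numT e).
pose rhs : formula R [:: treal] := setF [set a | `|a| < e] bv0.
pose phi : formula R [::] := ALL treal, (lhs |=> rhs) |& (rhs |=> lhs).
have /(transfer X phi) : std_holds phi by move=> a; split.
by apply.
Qed.

Lemma infinitesimal_hsubP y r :
  infinitesimal (hsub y (hreal X r)) <-> hfilter y --> r.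
Proof.
rewrite hfilter_cvgP.
by split=> yr e e0; apply/hlt_habs_hsub; exact: yr.
Qed.

Lemma hfilter_cvg_st y (r : R) : hfilter y --> r -> st y = r.
Proof.
move=> yr; rewrite /st; case: xgetP => [s _ /infinitesimal_hsubP ys|].
  exact: (cvg_unique _ ys yr).
by move=> /(_ r); case; apply/infinitesimal_hsubP.
Qed.

Lemma hfilter_cvg_finite y (r : R) : hfilter y --> r -> finite_hyperreal y.
Proof.
move=> yr; exists (`|r| + 1); apply/hlt_habs.
have /hfilter_cvgP/(_ 1 ltr01) := yr; apply: filterS => a /= ar.
rewrite -(subrK r a); apply: le_lt_trans (ler_normD _ _) _.
by rewrite addrC ltrD2l.
Qed.

(** * The hyperfinite grid and its rearranged values *)

Lemma hfilter_gridpt_unit (H i : hyperreal X) :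
  hindex H i -> hfilter (gridpt H i) `[0, 1]%classic.
Proof.
move=> /hindexP.
pose phi : formula R [::] := ALL treal, ALL treal,
  indexF bv1 bv0 |=> setF `[0, 1]%classic (gridT bv1 bv0).
have /(transfer X phi) : std_holds phi by move=> h k; exact: gridpt_unit.
by apply.
Qed.

Lemma hfilter_hfun_image (f : R -> R) A y :
  hfilter y A -> hfilter (ap (hfun X f) y) (f @` A).
Proof.
pose phi : formula R [::] :=
  ALL treal, setF A bv0 |=> setF (f @` A) (funT f bv0).
have /(transfer X phi) : std_holds phi by move=> a; exact: imageP.
by apply.
Qed.

Lemma hfilter_rearranged_image (f : R -> R) (H i : hyperreal X) psi :
  decreasing_arrangement f H psi -> hindex H i ->
  hfilter (rearranged f psi (gridpt H i)) (f @` `[0, 1]%classic).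
Proof.
move=> [[maps _ _] _ _] hi; apply: hfilter_hfun_image.
by have [m hm <-] := maps _ (imageP _ hi); exact: hfilter_gridpt_unit.
Qed.

(** The definition of an infinite hypernatural only says that it differs from
every standard natural number.  Discreteness of the naturals turns this into
lower bounds, one number at a time: the induction is on standard [n], outside
the transferred sentences. *)
Lemma infinite_hypernat_ge (H : hyperreal X) (C : R) :
  infinite_hypernat H -> hfilter H [set h | C <= h].
Proof.
move=> [NH infH].
have ge_nat n : hfilter H [set h | n%:R <= h].
  elim: n => [|n IHn].
    pose phi : formula R [::] :=
      ALL treal, natF bv0 |=> setF [set h | 0 <= h] bv0.
    have /(transfer X phi) : std_holds phi by move=> h /= [m _ <-].
    by apply.
  pose phi : formula R [::] := ALL treal,
    natF bv0 |=> setF [set h | n%:R <= h] bv0 |=>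
    fOr (fEq bv0 (numT n%:R)) (setF [set h | n.+1%:R <= h] bv0).
  have /(transfer X phi) : std_holds phi.
    move=> h /= [m _ <-]; rewrite !ler_nat leq_eqVlt.
    by move=> /orP[/eqP->|]; [left|right].
  by move=> /(_ H NH IHn) [HE|//]; exfalso; apply: infH; exists n.
apply: filterS (ge_nat (Num.truncn C).+1) => h /= Ch.
by apply: le_trans Ch; exact/ltW/truncnS_gt.
Qed.

(** By transfer some grid point lies within [H^-1] of [x], and [H^-1] is smaller
than every positive real. *)
Lemma grid_dense (H : hyperreal X) (x : R) :
  infinite_hypernat H -> x \in `[0, 1] ->
  exists2 i, hindex H i & hfilter (gridpt H i) --> x.
Proof.
move=> infH; rewrite in_itv/= => /andP[x_ge0 x_le1].
pose phi : formula R [::] := ALL treal, natF bv0 |=> leF (numT 1) bv0 |=>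
  EX treal, indexF bv1 bv0 |&
    relF (fun h => [set y | `|y - x| <= h^-1]) bv1 (gridT bv1 bv0).
have /(transfer X phi) : std_holds phi.
  move=> h /= [n _ <-] /= n1; have n0 : 0 < n%:R :> R by lra.
  have : 0 <= x * n%:R by rewrite mulr_ge0//; lra.
  move=> /truncn_itv/andP[]; set m := Num.truncn _ => mx xm.
  have close (k : nat) :
      `|k%:R - x * n%:R| <= 1 -> `|k%:R / n%:R - x| <= n%:R^-1.
    move=> kx; rewrite -{1}[x](@mulfK _ n%:R) ?gt_eqF// -mulrBl normrM.
    rewrite [ `|_^-1|]gtr0_norm ?invr_gt0//.
    by rewrite ler_piMl// invr_ge0 ltW.
  (* Round up, so that the index is positive; if this leaves the grid, then
     [x = 1]. *)
  have [mn|nm] := leqP m.+1 n.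
    exists m.+1%:R; split; last by apply: close; rewrite ler_norml; lra.
    by split; [exists m.+1|rewrite ler1n ler_nat].
  exists n%:R; split; first by split=> //; exists n.
  apply: close; rewrite ler_norml.
  have : n%:R <= m%:R :> R by rewrite ler_nat.
  have : x * n%:R <= n%:R by rewrite ler_piMl// ltW.
  by lra.
have [NH _] := infH; have H1 : hle (hreal X 1) H.
  pose chi : formula R [::] :=
    ALL treal, setF [set h | 1 <= h] bv0 |=> leF (numT 1) bv0.
  have /(transfer X chi) : std_holds chi by move=> h; exact.
  by apply; exact: infinite_hypernat_ge.
move=> /(_ H NH H1)[i [/hindexP iH Hix]]; exists i => //.
apply/hfilter_cvgP => e e0.
rewrite (hfilterE_snd H).
have large : hfilter2 H (gridpt H i) [set p | e^-1 + 1 <= p.1].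
  have := infinite_hypernat_ge (e^-1 + 1) infH.
  by rewrite (hfilterE_fst H (gridpt H i)).
have close : hfilter2 H (gridpt H i) [set p | `|p.2 - x| <= p.1^-1].
  exact: Hix.
apply: filterS2 large close => -[h y] /= eh yx; apply: le_lt_trans yx _.
have e1 : 0 < e^-1 by rewrite invr_gt0.
by rewrite invf_plt ?posrE; lra.
Qed.

(** Stated for arbitrary pairs of grid points: close standard parts give
continuity, and equal ones give independence of the representative. *)
Lemma standard_parts_modulus (f : R -> R) (H : hyperreal X) psi (e : R) :
  {within `[0, 1], continuous f} -> decreasing_arrangement f H psi -> 0 < e ->
  exists2 d : R, 0 < d & forall (i j : hyperreal X) (x y x' y' : R),
    hindex H i -> hindex H j ->
    hfilter (gridpt H i) --> x -> hfilter (gridpt H j) --> y ->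
    hfilter (rearranged f psi (gridpt H i)) --> x' ->
    hfilter (rearranged f psi (gridpt H j)) --> y' ->
    `|x - y| < d -> `|x' - y'| <= e.
Proof.
move=> fc hpsi e0; have [d d0 modulus] := arrangement_modulus fc e0.
exists d => // i j x y x' y' hi hj ix jy ix' jy' xyd.
have near_pts :
    \forall p \near hfilter2 (gridpt H i) (gridpt H j), `|p.1 - p.2| < d.
  exact: (cvgr_lt _ (hfilter2_cvg_dist ix jy) _ xyd).
have near_vals : hfilter2 (rearranged f psi (gridpt H i))
    (rearranged f psi (gridpt H j)) [set p | `|p.1 - p.2| < e].
  exact: modulus hpsi _ _ hi hj near_pts.
apply: cvgr_to_le (hfilter2_cvg_dist ix' jy') _.
by apply: filterS near_vals => p; exact: ltW.
Qed.

End Transfer.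

Theorem proposition8p1 (R : realType) (X : nonstandard_extension R)
    (f : R -> R) (hf : {within `[0, 1], continuous f})
    (H : hyperreal X) (hH : infinite_hypernat H)
    (psi : dom X (tfun treal treal))
    (hpsi : decreasing_arrangement f H psi) :
  exists g : R -> R, {within `[0, 1], continuous g} /\
    forall i : hyperreal X, hindex H i ->
      [/\ finite_hyperreal (gridpt H i),
          finite_hyperreal (rearranged f psi (gridpt H i))
        & g (st (gridpt H i)) = st (rearranged f psi (gridpt H i))].
Proof.
have imf : compact (f @` `[0, 1]%classic).
  by apply: continuous_compact; [exact: hf|exact: segment_compact].
have value_cvg i : hindex H i ->
    exists r : R, hfilter (rearranged f psi (gridpt H i)) --> r.
  move=> hi; have := hfilter_rearranged_image hpsi hi.
  by move=> /(hfilter_compact_cvg imf)[r _ ir]; exists r.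
have gE (x : R) : exists r : R, x \in `[0, 1] -> exists i : hyperreal X,
    [/\ hindex H i, hfilter (gridpt H i) --> x
      & hfilter (rearranged f psi (gridpt H i)) --> r].
  have [x01|nx] := boolP (x \in `[0, 1]); last by exists 0.
  have [i hi ix] := grid_dense hH x01.
  by have [r ir] := value_cvg i hi; exists r => _; exists i.
have [g gP] := choice gE; exists g; split=> [|i hi].
  apply/subspace_continuousP => x x01; apply/cvgrPdist_le => e e0.
  have [d d0 modulus] := standard_parts_modulus hf hpsi e0.
  have [i [hi ix igx]] := gP x x01.
  rewrite near_withinE; apply/nbhs_ballP; exists d => //= y xy y01.
  have [j [hj jy jgy]] := gP y y01.
  exact: modulus hi hj ix jy igx jgy xy.
have [x x01 ix] :=
  hfilter_compact_cvg (@segment_compact R 0 1) (hfilter_gridpt_unit hi).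
have [r ir] := value_cvg i hi.
split; [exact: hfilter_cvg_finite ix|exact: hfilter_cvg_finite ir|].
rewrite (hfilter_cvg_st ix) (hfilter_cvg_st ir).
(* [g x] is the value at some grid point [j] near [x], possibly not [i]. *)
have [j [hj jx jgx]] := gP x x01.
apply/eqP; rewrite -subr_eq0 -normr_le0; apply/ler_addgt0Pr => e e0.
have [d d0 modulus] := standard_parts_modulus hf hpsi e0.
by rewrite add0r; apply: modulus hj hi jx ix jgx ir _; rewrite subrr normr0.
Qed.
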